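(* For a meet-semilattice $\mathcal M$, let $i_{\mathcal M}:\mathcal M\to B_{\mathcal M}$ be the free Boolean algebra on $\mathcal M$, and let $\le_{\mathcal M}$ be the order on $Spec(B_{\mathcal M})$ given by $F\le_{\mathcal M}F'$ iff $F\cap\mathcal M\subseteq F'\cap\mathcal M$ (where $\mathcal M$ is regarded as a subset of $B_{\mathcal M}$ via $i_{\mathcal M}$). Set $\tilde B(\mathcal M)=(B_{\mathcal M},\le_{\mathcal M})$, and for a meet-semilattice homomorphism $f:\mathcal M\to\mathcal N$ let $\tilde B(f):B_{\mathcal M}\to B_{\mathcal N}$ be the unique Boolean algebra homomorphism with $\tilde B(f)\circ i_{\mathcal M}=i_{\mathcal N}\circ f$. Then $\tilde B:\mathbf{MsLat}\to\mathbf{Bool}_{\le}$ is a functor which is an equivalence onto its extended image $ExtIm(\tilde B)$; any $\mathcal M$ can be recovered up to isomorphism as the set of indecomposable $\le_{\mathcal M}$-upper elements of $B_{\mathcal M}$, and any arrow $f$ as the restriction of $\tilde B(f)$ to these subsets. Moreover: (1) The objects of $ExtIm(\tilde B)$ are the objects $(B,\le)$ of $\mathbf{Bool}_{\le}$ such that for any $F,F'\in Spec(B)$ with $F\nleq F'$ there is an indecomposable $\le$-upper element $b\in B$ with $b\in F$ and $b\notin F'$, and the meet of any two indecomposable $\le$-upper elements is indecomposable. Equivalently, they are the objects such that the subset $B^{*}$ of indecomposable $\le$-upper elements of $B$, with the induced order, is a meet-semilattice, the inclusion $B^{*}\subseteq B$ realizes $B$ as the free Boolean algebra on the meet-semilattice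 $B^{*}$, and for any $F,F'\in Spec(B)$ with $F\nleq F'$ there is an indecomposable $\le$-upper element $b\in B$ with $b\in F$ and $b\notin F'$. (2) The arrows $(B,\le)\to(B',\le')$ of $ExtIm(\tilde B)$ are the Boolean algebra homomorphisms $f:B\to B'$ such that $f^{-1}:Spec(B')\to Spec(B)$ is order-preserving and $f$ sends indecomposable $\le$-upper elements of $B$ to indecomposable $\le'$-upper elements of $B'$.
   Context: Meet-semilattices have a top element, and meet-semilattice homomorphisms preserve binary meets and the top element; $\mathbf{MsLat}$ is the resulting category. The free Boolean algebra on $\mathcal M$ is a Boolean algebra $B_{\mathcal M}$ with a meet-semilattice homomorphism $i_{\mathcal M}:\mathcal M\to B_{\mathcal M}$ along which every meet-semilattice homomorphism from $\mathcal M$ to a Boolean algebra extends uniquely to a Boolean algebra homomorphism. $Spec(B)$ is the set of prime filters of the Boolean algebra $B$. Given an order $\le$ on $Spec(B)$, an element $b\in B$ is $\le$-upper if for any $G,G'\in Spec(B)$ with $G\le G'$, $b\in G$ implies $b\in G'$. A $\le$-upper element is indecomposable if it cannot be written as a proper finite join of $\le$-upper elements, i.e. whenever it is the join of a finite family of $\le$-upper elements it equals a member of that family. $\mathbf{Bool}_{\le}$: objects are pairs $(B,\le)$ with $B$ a Boolean algebra and $\le$ an order on $Spec(B)$ such that for any $F,F'\in Spec(B)$ with $F\nleq F'$ there is a $\le$-upper $b\in B$ with $b\in F$, $b\notin F'$; arrows $(B,\le)\to(B',\le')$ are Boolean algebra homomorphisms $f:B\to B'$ such that $f^{-1}:Spec(B')\to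 Spec(B)$ is order-preserving, i.e. $F\le'F'$ in $Spec(B')$ implies $f^{-1}(F)\le f^{-1}(F')$ in $Spec(B)$. The extended image of a functor $F:\mathcal U\to\mathcal V$ is the smallest subcategory of $\mathcal V$ closed under isomorphisms in $\mathcal V$ through which $F$ factors.
   Formalization: In the first form of (1), the top element of B is also required to be indecomposable (closure under the empty meet), since closure under binary meets alone admits objects outside the extended image, such as the trivial Boolean algebra. *)

(* Defs.v *)
From HB Require Import structures.
From mathcomp Require Import all_boot all_order generic_quotient.
From mathcomp Require Import boolp.

Set Implicit Arguments.
Unset Strict Implicit.
Unset Printing Implicit Defensive.

Import Order.Theory.
Local Open Scope order_scope.

#[local] Obligation Tactic := try by [].

Record category := Category {
  ob :> Type;
  hom : ob -> ob -> Type;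
  idm : forall X, hom X X;
  compose : forall X Y Z, hom Y Z -> hom X Y -> hom X Z;
  comp_idl : forall X Y (f : hom X Y), compose (idm Y) f = f;
  comp_idr : forall X Y (f : hom X Y), compose f (idm X) = f;
  comp_assoc : forall W X Y Z (h : hom Y Z) (g : hom X Y) (f : hom W X),
    compose h (compose g f) = compose (compose h g) f }.
Arguments hom {c} X Y.
Arguments idm {c} X.
Arguments compose {c X Y Z} g f.

Definition is_iso (C : category) (X Y : C) (f : hom X Y) : Prop :=
  exists g : hom Y X, compose g f = idm X /\ compose f g = idm Y.

Record functor (C D : category) := Functor {
  fob :> C -> D;
  fmap : forall X Y : C, hom X Y -> hom (fob X) (fob Y);
  fmap_id : forall X : C, fmap (idm X) = idm (fob X);
  fmap_comp : forall (X Y Z : C) (g : hom Y Z) (f : hom X Y),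
    fmap (compose g f) = compose (fmap g) (fmap f) }.
Arguments Functor {C D fob} fmap fmap_id fmap_comp.
Arguments fmap {C D} F {X Y} f : rename.

Program Definition functor_id (C : category) : functor C C :=
  @Functor C C (fun X => X) (fun _ _ f => f) _ _.

Program Definition functor_comp (C D E : category)
    (G : functor D E) (F : functor C D) : functor C E :=
  @Functor C E (fun X => G (F X)) (fun _ _ f => fmap G (fmap F f)) _ _.
Next Obligation. by move=> C D E G F X /=; rewrite !fmap_id. Qed.
Next Obligation. by move=> C D E G F X Y Z g f /=; rewrite !fmap_comp. Qed.

Definition naturally_isomorphic (C D : category) (F G : functor C D) : Prop :=
  exists eta : forall X : C, hom (F X) (G X),
    (forall X, is_iso (eta X)) /\
    (forall (X Y : C) (f : hom X Y),
       compose (eta Y) (fmap F f) = compose (fmap G f) (eta X)).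

Definition is_equivalence (C D : category) (F : functor C D) : Prop :=
  exists G : functor D C,
    naturally_isomorphic (functor_comp G F) (functor_id C) /\
    naturally_isomorphic (functor_comp F G) (functor_id D).

Record subcategory (C : category) := Subcategory {
  sub_ob : C -> Prop;
  sub_hom : forall X Y : C, hom X Y -> Prop;
  sub_dom : forall (X Y : C) (f : hom X Y), sub_hom f -> sub_ob X;
  sub_cod : forall (X Y : C) (f : hom X Y), sub_hom f -> sub_ob Y;
  sub_id : forall X : C, sub_ob X -> sub_hom (idm X);
  sub_comp : forall (X Y Z : C) (g : hom Y Z) (f : hom X Y),
    sub_hom g -> sub_hom f -> sub_hom (compose g f) }.
Arguments sub_hom {C} S {X Y} f : rename.

Lemma sig_ext (T : Type) (P : T -> Prop) (u v : {x | P x}) :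
  sval u = sval v -> u = v.
Proof. by case: u v => [x px] [y py] /= e; subst y; congr exist; exact: Prop_irrelevance. Qed.

Program Definition subcategory_category (C : category) (S : subcategory C) : category :=
  @Category {X : C | sub_ob S X}
    (fun X Y => {f : hom (sval X) (sval Y) | sub_hom S f})
    (fun X => exist _ (idm (sval X)) _)
    (fun X Y Z g f => exist _ (compose (sval g) (sval f)) _) _ _ _.
Next Obligation. by move=> C S [X hX]; exact: sub_id. Qed.
Next Obligation. by move=> C S X Y Z [g hg] [f hf]; exact: sub_comp. Qed.
Next Obligation. by move=> C S X Y f; apply: sig_ext; exact: comp_idl. Qed.
Next Obligation. by move=> C S X Y f; apply: sig_ext; exact: comp_idr. Qed.
Next Obligation. by move=> C S W X Y Z h g f; apply: sig_ext; exact: comp_assoc. Qed.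

(* Applied to inverses, this covers the isomorphisms with codomain in S as well. *)
Definition closed_under_isos (C : category) (S : subcategory C) : Prop :=
  forall (X Y : C) (f : hom X Y), is_iso f -> sub_ob S X -> sub_ob S Y /\ sub_hom S f.

Definition factors_through (C D : category) (F : functor C D) (S : subcategory D) : Prop :=
  (forall X : C, sub_ob S (F X)) /\
  (forall (X Y : C) (f : hom X Y), sub_hom S (fmap F f)).

(* The intersection of all the isomorphism-closed subcategories through which F factors. *)
Program Definition ExtIm (C D : category) (F : functor C D) : subcategory D :=
  @Subcategory D
    (fun X => forall S : subcategory D,
       closed_under_isos S -> factors_through F S -> sub_ob S X)
    (fun X Y f => forall S : subcategory D,
       closed_under_isos S -> factors_through F S -> sub_hom S f) _ _ _ _.
Next Obligation. by move=> C D F X Y f hf S hS hF; exact: sub_dom (hf S hS hF). Qed.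
Next Obligation. by move=> C D F X Y f hf S hS hF; exact: sub_cod (hf S hS hF). Qed.
Next Obligation. by move=> C D F X hX S hS hF; exact: sub_id (hX S hS hF). Qed.
Next Obligation.
by move=> C D F X Y Z g f hg hf S hS hF; exact: sub_comp (hg S hS hF) (hf S hS hF).
Qed.

Program Definition to_ExtIm (C D : category) (F : functor C D) :
    functor C (subcategory_category (ExtIm F)) :=
  @Functor C (subcategory_category (ExtIm F))
    (fun X => exist _ (F X) _) (fun X Y f => exist _ (fmap F f) _) _ _.
Next Obligation. by move=> C D F X S _ [hF _]; exact: hF. Qed.
Next Obligation. by move=> C D F X Y f S _ [_ hF]; exact: hF. Qed.
Next Obligation. by move=> C D F X; apply: sig_ext; exact: fmap_id. Qed.
Next Obligation. by move=> C D F X Y Z g f; apply: sig_ext; exact: fmap_comp. Qed.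

Record mslHom d (M : tMeetSemilatticeType d) d' (N : tMeetSemilatticeType d') := MslHom {
  mslHom_fun :> M -> N;
  mslHomI : {morph mslHom_fun : x y / x `&` y};
  mslHom1 : mslHom_fun \top = \top }.

(* Not {tblmorphism A -> B}, which only records the preservation of \bot and \top. *)
Record boolHom d (A : ctbDistrLatticeType d) d' (B : ctbDistrLatticeType d') := BoolHom {
  boolHom_fun :> A -> B;
  boolHomI : {morph boolHom_fun : x y / x `&` y};
  boolHomU : {morph boolHom_fun : x y / x `|` y};
  boolHom0 : boolHom_fun \bot = \bot;
  boolHom1 : boolHom_fun \top = \top;
  boolHomC : {morph boolHom_fun : x / ~` x} }.

Lemma mslHom_ext d (M : tMeetSemilatticeType d) d' (N : tMeetSemilatticeType d')
  (f g : mslHom M N) : f =1 g -> f = g.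
Proof.
case: f g => [f f1 f2] [g g1 g2] /= /funext e; subst g.
by congr MslHom; exact: Prop_irrelevance.
Qed.

Lemma boolHom_ext d (A : ctbDistrLatticeType d) d' (B : ctbDistrLatticeType d')
  (f g : boolHom A B) : f =1 g -> f = g.
Proof.
case: f g => [f f1 f2 f3 f4 f5] [g g1 g2 g3 g4 g5] /= /funext e; subst g.
by congr BoolHom; exact: Prop_irrelevance.
Qed.

Program Definition mslHom_id d (M : tMeetSemilatticeType d) : mslHom M M :=
  @MslHom _ M _ M id _ _.

Program Definition mslHom_comp d (M : tMeetSemilatticeType d) d' (N : tMeetSemilatticeType d')
    d'' (P : tMeetSemilatticeType d'') (g : mslHom N P) (f : mslHom M N) : mslHom M P :=
  @MslHom _ M _ P (fun x => g (f x)) _ _.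
Next Obligation. by move=> d M d' N d'' P g f x y /=; rewrite !mslHomI. Qed.
Next Obligation. by move=> d M d' N d'' P g f /=; rewrite !mslHom1. Qed.

Program Definition boolHom_id d (A : ctbDistrLatticeType d) : boolHom A A :=
  @BoolHom _ A _ A id _ _ _ _ _.

Program Definition boolHom_comp d (A : ctbDistrLatticeType d) d' (B : ctbDistrLatticeType d')
    d'' (C : ctbDistrLatticeType d'') (g : boolHom B C) (f : boolHom A B) : boolHom A C :=
  @BoolHom _ A _ C (fun x => g (f x)) _ _ _ _ _.
Next Obligation. by move=> d A d' B d'' C g f x y /=; rewrite !boolHomI. Qed.
Next Obligation. by move=> d A d' B d'' C g f x y /=; rewrite !boolHomU. Qed.
Next Obligation. by move=> d A d' B d'' C g f /=; rewrite !boolHom0. Qed.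
Next Obligation. by move=> d A d' B d'' C g f /=; rewrite !boolHom1. Qed.
Next Obligation. by move=> d A d' B d'' C g f x /=; rewrite !boolHomC. Qed.

Record mslat := Mslat {
  mslat_disp : Order.disp_t;
  mslat_sort :> tMeetSemilatticeType mslat_disp }.

Definition MsLat : category.
Proof.
refine (@Category mslat (fun M N => mslHom M N) (fun M => mslHom_id M)
  (fun M N P g f => mslHom_comp g f) _ _ _).
- by move=> *; exact: mslHom_ext.
- by move=> *; exact: mslHom_ext.
- by move=> *; exact: mslHom_ext.
Defined.

(* exists! is up to Leibniz equality of homomorphisms; see boolHom_ext. *)
Definition is_free d (M : tMeetSemilatticeType d) d' (B : ctbDistrLatticeType d')
    (i : mslHom M B) : Prop :=
  forall d'' (A : ctbDistrLatticeType d'') (f : mslHom M A),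
    exists! g : boolHom B A, forall x : M, g (i x) = f x.

Record freeBool d (M : tMeetSemilatticeType d) := FreeBool {
  freeBool_disp : Order.disp_t;
  freeBool_alg :> ctbDistrLatticeType freeBool_disp;
  freeBool_unit : mslHom M freeBool_alg;
  freeBoolP : is_free freeBool_unit }.

Definition freeBool_lift d (M : tMeetSemilatticeType d) (B : freeBool M)
    d' (A : ctbDistrLatticeType d') (f : mslHom M A) : boolHom B A :=
  projT1 (cid (freeBoolP B f)).

Definition Bmap (B : forall M : mslat, freeBool M) (M N : mslat) (f : mslHom M N) :
    boolHom (B M) (B N) :=
  freeBool_lift (B M) (mslHom_comp (freeBool_unit (B N)) f).

(* Free Boolean algebras exist: Boolean terms over M, modulo having the same value under
   every homomorphism to a Boolean algebra. *)
Inductive bterm (T : Type) : Type :=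
| Gen of T | Bot | Top | Neg of bterm T
| And of bterm T & bterm T | Or of bterm T & bterm T.
Arguments Bot {T}.
Arguments Top {T}.
HB.instance Definition _ (T : Type) := gen_eqMixin (bterm T).
HB.instance Definition _ (T : Type) := gen_choiceMixin (bterm T).

Fixpoint beval (T : Type) d (A : ctbDistrLatticeType d) (f : T -> A) (t : bterm T) : A :=
  match t with
  | Gen x => f x
  | Bot => \bot
  | Top => \top
  | Neg t => ~` beval f t
  | And t u => beval f t `&` beval f u
  | Or t u => beval f t `|` beval f u
  end.

Section TermAlgebra.
Variables (d : Order.disp_t) (M : tMeetSemilatticeType d).

Definition bequiv (t u : bterm M) : bool :=
  `[< forall d' (A : ctbDistrLatticeType d') (f : mslHom M A), beval f t = beval f u >].

Lemma bequiv_refl : reflexive bequiv. Proof. by move=> t; apply/asboolP. Qed.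
Lemma bequiv_sym : symmetric bequiv.
Proof. by move=> t u; apply/asboolP/asboolP => h d' A f; rewrite h. Qed.
Lemma bequiv_trans : transitive bequiv.
Proof.
by move=> t u v /asboolP h1 /asboolP h2; apply/asboolP => d' A f; rewrite h1.
Qed.
Canonical bequiv_equiv := EquivRel bequiv bequiv_refl bequiv_sym bequiv_trans.

Definition termAlg : Type := {eq_quot bequiv}%qT.
HB.instance Definition _ := Choice.on termAlg.

Definition cls (t : bterm M) : termAlg := (\pi_({eq_quot bequiv}%qT) t)%qT.
Definition rep (x : termAlg) : bterm M := repr (x : {eq_quot bequiv}%qT).
Definition tval d' (A : ctbDistrLatticeType d') (f : mslHom M A) (x : termAlg) : A :=
  beval f (rep x).

Lemma tval_cls d' (A : ctbDistrLatticeType d') (f : mslHom M A) t :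
  tval f (cls t) = beval f t.
Proof.
have /eqmodP/asboolP h :
    (repr (cls t : {eq_quot bequiv}%qT) = t %[mod {eq_quot bequiv}%qT])%qT.
  by rewrite reprK.
exact: h.
Qed.

Lemma tval_ext (x y : termAlg) :
  (forall d' (A : ctbDistrLatticeType d') (f : mslHom M A), tval f x = tval f y) -> x = y.
Proof.
move=> h; rewrite -[x](@reprK _ {eq_quot bequiv}%qT) -[y](@reprK _ {eq_quot bequiv}%qT).
by apply/eqmodP/asboolP => d' A f; exact: h.
Qed.

Definition tI (x y : termAlg) := cls (And (rep x) (rep y)).
Definition tU (x y : termAlg) := cls (Or (rep x) (rep y)).
Definition tC (x : termAlg) := cls (Neg (rep x)).
Definition t0 : termAlg := cls Bot.
Definition t1 : termAlg := cls Top.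

Lemma tvalI d' (A : ctbDistrLatticeType d') (f : mslHom M A) x y :
  tval f (tI x y) = tval f x `&` tval f y. Proof. by rewrite tval_cls. Qed.
Lemma tvalU d' (A : ctbDistrLatticeType d') (f : mslHom M A) x y :
  tval f (tU x y) = tval f x `|` tval f y. Proof. by rewrite tval_cls. Qed.
Lemma tvalC d' (A : ctbDistrLatticeType d') (f : mslHom M A) x :
  tval f (tC x) = ~` tval f x. Proof. by rewrite tval_cls. Qed.
Lemma tval0 d' (A : ctbDistrLatticeType d') (f : mslHom M A) :
  tval f t0 = \bot. Proof. by rewrite tval_cls. Qed.
Lemma tval1 d' (A : ctbDistrLatticeType d') (f : mslHom M A) :
  tval f t1 = \top. Proof. by rewrite tval_cls. Qed.
Let tvalE := (tvalI, tvalU, tvalC, tval0, tval1).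

Fact tIC : commutative tI.
Proof. by move=> x y; apply: tval_ext => *; rewrite !tvalE meetC. Qed.
Fact tUC : commutative tU.
Proof. by move=> x y; apply: tval_ext => *; rewrite !tvalE joinC. Qed.
Fact tIA : associative tI.
Proof. by move=> x y z; apply: tval_ext => *; rewrite !tvalE meetA. Qed.
Fact tUA : associative tU.
Proof. by move=> x y z; apply: tval_ext => *; rewrite !tvalE joinA. Qed.
Fact tUKI (y x : termAlg) : tI x (tU x y) = x.
Proof. by apply: tval_ext => *; rewrite !tvalE joinKI. Qed.
Fact tIKU (y x : termAlg) : tU x (tI x y) = x.
Proof. by apply: tval_ext => *; rewrite !tvalE meetKU. Qed.
Fact tIUl : left_distributive tI tU.
Proof. by move=> x y z; apply: tval_ext => *; rewrite !tvalE meetUl. Qed.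
Fact tIxx : idempotent_op tI.
Proof. by move=> x; apply: tval_ext => *; rewrite !tvalE meetxx. Qed.

HB.instance Definition _ := @Order.isMeetJoinDistrLattice.Build (Order.Disp tt tt) termAlg
  (fun x y => tI x y == x) (fun x y => (y != x) && (tI x y == x)) tI tU
  (fun _ _ => erefl) (fun _ _ => erefl) tIC tUC tIA tUA tUKI tIKU tIUl tIxx.

Fact t0_le (x : termAlg) : t0 <= x.
Proof. by apply/eqP; apply: tval_ext => *; rewrite !tvalE meet0x. Qed.
Fact le_t1 (x : termAlg) : x <= t1.
Proof. by apply/eqP; apply: tval_ext => *; rewrite !tvalE meetx1. Qed.

HB.instance Definition _ := @Order.hasBottom.Build _ termAlg t0 t0_le.
HB.instance Definition _ := @Order.hasTop.Build _ termAlg t1 le_t1.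

Fact tUxC (x : termAlg) : x `|` tC x = \top.
Proof. by apply: tval_ext => *; rewrite !tvalE joinxC. Qed.
Fact tIxC (x : termAlg) : x `&` tC x = \bot.
Proof. by apply: tval_ext => *; rewrite !tvalE meetxC. Qed.

HB.instance Definition _ := @Order.TBDistrLattice_hasComplement.Build _ termAlg tC tUxC tIxC.

Program Definition term_unit : mslHom M termAlg := @MslHom _ M _ termAlg (fun x => cls (Gen x)) _ _.
Next Obligation.
by move=> x y; apply: tval_ext => *; rewrite !tvalE !tval_cls /= mslHomI.
Qed.
Next Obligation. by apply: tval_ext => *; rewrite !tvalE !tval_cls /= mslHom1. Qed.

Program Definition tval_hom d' (A : ctbDistrLatticeType d') (f : mslHom M A) :
    boolHom termAlg A := @BoolHom _ termAlg _ A (tval f) _ _ _ _ _.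
Next Obligation. by move=> d' A f x y; exact: tvalI. Qed.
Next Obligation. by move=> d' A f x y; exact: tvalU. Qed.
Next Obligation. by move=> d' A f; exact: tval0. Qed.
Next Obligation. by move=> d' A f; exact: tval1. Qed.
Next Obligation. by move=> d' A f x; exact: tvalC. Qed.

Lemma clsE (t : bterm M) : cls t = beval (term_unit : M -> termAlg) t.
Proof.
elim: t => [x|||t IH|t IHt u IHu|t IHt u IHu] //=; rewrite -?IH -?IHt -?IHu;
  apply: tval_ext => d' A f.
- by rewrite [RHS]tvalC !tval_cls.
- by rewrite [RHS]tvalI !tval_cls.
- by rewrite [RHS]tvalU !tval_cls.
Qed.

Lemma term_unit_free : is_free term_unit.
Proof.
move=> d' A f; exists (tval_hom f); split=> [x|g hg]; first by rewrite /= tval_cls.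
apply: boolHom_ext => x; rewrite -[x](@reprK _ {eq_quot bequiv}%qT) /= -/(cls _) tval_cls clsE.
elim: (repr _) => [y|||t IH|t IHt u IHu|t IHt u IHu] /=.
- by rewrite hg.
- by rewrite boolHom0.
- by rewrite boolHom1.
- by rewrite boolHomC IH.
- by rewrite boolHomI IHt IHu.
- by rewrite boolHomU IHt IHu.
Qed.

Definition term_freeBool : freeBool M := FreeBool term_unit_free.

End TermAlgebra.

Record is_prime_filter d (B : ctbDistrLatticeType d) (F : B -> Prop) : Prop := IsPrimeFilter {
  prime_filter1 : F \top;
  prime_filter_le : forall x y, x <= y -> F x -> F y;
  prime_filterI : forall x y, F x -> F y -> F (x `&` y);
  prime_filter0 : ~ F \bot;
  prime_filterU : forall x y, F (x `|` y) -> F x \/ F y }.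

Record Spec d (B : ctbDistrLatticeType d) := MkSpec {
  spec_set :> B -> Prop;
  spec_prime : is_prime_filter spec_set }.

Lemma preimage_prime d (A : ctbDistrLatticeType d) d' (B : ctbDistrLatticeType d')
  (f : boolHom A B) (F : Spec B) : is_prime_filter (fun a => F (f a)).
Proof.
case: F => F [h1 hle hI h0 hU] /=; split.
- by rewrite boolHom1.
- by move=> x y /meet_idPl xy; apply: hle; apply/meet_idPl; rewrite -boolHomI xy.
- by move=> x y fx fy; rewrite boolHomI; exact: hI.
- by rewrite boolHom0.
- by move=> x y; rewrite boolHomU; exact: hU.
Qed.

Definition spec_map d (A : ctbDistrLatticeType d) d' (B : ctbDistrLatticeType d')
    (f : boolHom A B) (F : Spec B) : Spec A :=
  MkSpec (preimage_prime f F).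

Section Upper.
Variables (d : Order.disp_t) (B : ctbDistrLatticeType d).
Variable le : Spec B -> Spec B -> Prop.

Definition upper (b : B) : Prop := forall G G' : Spec B, le G G' -> G b -> G' b.

(* The family s may be empty, so \bot is not indecomposable. *)
Definition indecomposable (b : B) : Prop :=
  upper b /\
  (forall s : seq B, (forall x, x \in s -> upper x) ->
     b = \join_(x <- s) x -> b \in s).

Definition is_order : Prop :=
  [/\ forall F, le F F,
      forall F G H, le F G -> le G H -> le F H &
      forall F G, le F G -> le G F -> F = G].

Definition separated_by (P : B -> Prop) : Prop :=
  forall F F' : Spec B, ~ le F F' -> exists b : B, [/\ P b, F b & ~ F' b].

Definition boolLe_axiom : Prop := is_order /\ separated_by upper.

End Upper.

Definition spec_monotone d (A : ctbDistrLatticeType d) (leA : Spec A -> Spec A -> Prop)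
    d' (B : ctbDistrLatticeType d') (leB : Spec B -> Spec B -> Prop) (f : boolHom A B) : Prop :=
  forall F F' : Spec B, leB F F' -> leA (spec_map f F) (spec_map f F').

Record boolLe := MkBoolLe {
  boolLe_disp : Order.disp_t;
  boolLe_alg :> ctbDistrLatticeType boolLe_disp;
  boolLe_le : Spec boolLe_alg -> Spec boolLe_alg -> Prop;
  boolLeP : boolLe_axiom boolLe_le }.

Record boolLeHom (X Y : boolLe) := MkBoolLeHom {
  boolLeHom_fun :> boolHom X Y;
  boolLeHomP : spec_monotone (@boolLe_le X) (@boolLe_le Y) boolLeHom_fun }.

Lemma boolLeHom_ext (X Y : boolLe) (f g : boolLeHom X Y) : f =1 g -> f = g.
Proof.
case: f g => [f hf] [g hg] /= /boolHom_ext e; subst g.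
by congr MkBoolLeHom; exact: Prop_irrelevance.
Qed.

Program Definition boolLeHom_id (X : boolLe) : boolLeHom X X :=
  @MkBoolLeHom X X (boolHom_id X) _.
Next Obligation.
have e (X : boolLe) (F : Spec X) : spec_map (boolHom_id X) F = F.
  by case: F => F hF; congr MkSpec; exact: Prop_irrelevance.
by move=> X F F'; rewrite !e.
Qed.

Program Definition boolLeHom_comp (X Y Z : boolLe) (g : boolLeHom Y Z) (f : boolLeHom X Y) :
    boolLeHom X Z := @MkBoolLeHom X Z (boolHom_comp g f) _.
Next Obligation.
move=> X Y Z g f F F' h.
have e (G : Spec Z) : spec_map (boolHom_comp g f) G = spec_map f (spec_map g G).
  by congr MkSpec; exact: Prop_irrelevance.
by rewrite !e; do 2 apply: boolLeHomP.
Qed.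

Definition BoolLe : category.
Proof.
refine (@Category boolLe boolLeHom boolLeHom_id boolLeHom_comp _ _ _).
- by move=> *; exact: boolLeHom_ext.
- by move=> *; exact: boolLeHom_ext.
- by move=> *; exact: boolLeHom_ext.
Defined.

Arguments boolLe_le : clear implicits.

Definition free_le d (M : tMeetSemilatticeType d) (B : freeBool M) (F F' : Spec B) : Prop :=
  forall m : M, F (freeBool_unit B m) -> F' (freeBool_unit B m).
Arguments free_le {d M} B F F'.

Definition is_msl d (B : porderType d) (P : B -> Prop) : Prop :=
  (exists t, P t /\ forall x, P x -> x <= t) /\
  (forall x y, P x -> P y -> exists z, P z /\
     forall w, P w -> (w <= z) = (w <= x) && (w <= y)).

Definition induced d (B : porderType d) (P : B -> Prop) (h : is_msl P) : Type :=
  {x : B | `[< P x >]}.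

Section Induced.
Variables (d : Order.disp_t) (B : porderType d) (P : B -> Prop) (h : is_msl P).

HB.instance Definition _ := SubChoice.on (induced h).
HB.instance Definition _ := [SubChoice_isSubPOrder of induced h by <: with d].

Fact induced_meetP (x y : induced h) :
  exists z : induced h, forall w : induced h, (w <= z) = (w <= x) && (w <= y).
Proof.
case: x y => [x px] [y py].
have [z [pz hz]] := h.2 x y (asboolW px) (asboolW py).
exists (exist _ z (asboolT pz)) => -[w pw].
by rewrite !leEsub /=; exact: hz (asboolW pw).
Qed.

Fact induced_topP : exists t : induced h, forall x : induced h, x <= t.
Proof.
have [t [pt ht]] := h.1; exists (exist _ t (asboolT pt)) => -[x px].
by rewrite leEsub /=; exact: ht (asboolW px).
Qed.

HB.instance Definition _ := @Order.POrder_isMeetSemilattice.Build d (induced h)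
  (fun x y => projT1 (cid (induced_meetP x y)))
  (fun x y z => projT2 (cid (induced_meetP y z)) x).
HB.instance Definition _ := @Order.hasTop.Build d (induced h)
  (projT1 (cid induced_topP)) (projT2 (cid induced_topP)).

End Induced.

(* The inclusion is a homomorphism of meet-semilattices along which B is free on P. *)
Definition free_on_subset d (B : ctbDistrLatticeType d) (P : B -> Prop) (h : is_msl P) : Prop :=
  exists2 i : mslHom (induced h) B, (forall x, i x = val x) & is_free i.

(* Main.v *)
Require Import Defs.
From mathcomp Require Import all_boot all_order boolp.
From mathcomp Require classical_sets.
Set Implicit Arguments.
Unset Strict Implicit.
Unset Printing Implicit Defensive.
Import Order.Theory.
Local Open Scope order_scope.

(** Everything is read off from prime filters. By freeness, the prime filters of
    the free Boolean algebra on M are the homomorphisms from M to the two-element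
    lattice, that is, the filters of M ([filter_spec]), ordered by inclusion. The
    principal filter of m is the least prime filter containing the generator m, so
    a join of upper elements equal to m has a member above m: generators are
    indecomposable ([unit_indecomposable]). Conversely a compactness argument
    writes every upper element as a finite join of generators ([upper_join]), so
    an indecomposable upper element is a generator. Hence M and the maps between
    semilattices can be read off from the ordered Boolean algebras, and the functor
    is faithful, and full onto the morphisms that preserve indecomposables.

    Now take any (X, le) whose indecomposables separate the order and are closed
    under finite meets. They form a semilattice M, and the inclusion extends to a
    morphism e from the free algebra on M to X. It is injective ([recover_inj])
    because every filter of M is the trace of a prime filter of X: an
    indecomposable below a finite join of indecomposables is below one of them, so
    a filter and the complementary set of indecomposables can be separated. It is
    surjective ([recover_surj]) because indecomposables separate the order, hence
    the points of Spec X, and a subalgebra separating points is everything. The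
    separation also says that e identifies the two orders, so X is isomorphic to an
    object in the image of the functor.

    The objects of this kind, with the morphisms preserving indecomposables, form
    an isomorphism-closed subcategory, and each of its arrows is, up to such
    isomorphisms, in the image of the functor: this subcategory is the extended
    image ([extIm_ob], [extIm_hom]). The compactness behind all this is the prime
    filter theorem [prime_separation]. *)

(** * Equivalences of categories *)

Lemma ff_eso_equivalence (C D : category) (F : functor C D) :
    (forall (X Y : C) (g : hom (F X) (F Y)), exists! f : hom X Y, fmap F f = g) ->
    (forall Z : D, exists (X : C) (e : hom (F X) Z), is_iso e) ->
  is_equivalence F.
Proof.
move=> ff eso.
pose pre X Y (g : hom (F X) (F Y)) : hom X Y := sval (cid (ff X Y g)).
have preK X Y (g : hom (F X) (F Y)) : fmap F (pre X Y g) = g.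
  by rewrite /pre; case: cid => f [].
have faith X Y (f f' : hom X Y) : fmap F f = fmap F f' -> f = f'.
  move=> e; have [h [_ u]] := ff _ _ (fmap F f).
  by rewrite -(u f erefl) -(u f' (esym e)).
pose G0 Z : C := sval (cid (eso Z)).
have ex Z : {e : hom (F (G0 Z)) Z & {e' : hom Z (F (G0 Z)) |
    compose e' e = idm _ /\ compose e e' = idm _}}.
  rewrite /G0; case: cid => /= X /cid[e /cid[e' h]].
  by exists e; exists e'.
pose e Z := projT1 (ex Z); pose e' Z := sval (projT2 (ex Z)).
have e'e Z : compose (e' Z) (e Z) = idm _ := (svalP (projT2 (ex Z))).1.
have ee' Z : compose (e Z) (e' Z) = idm _ := (svalP (projT2 (ex Z))).2.
pose G1 Y Z (g : hom Y Z) : hom (G0 Y) (G0 Z) :=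
  pre _ _ (compose (e' Z) (compose g (e Y))).
have G1id Z : G1 _ _ (idm Z) = idm (G0 Z).
  by apply: faith; rewrite preK fmap_id comp_idl e'e.
have G1comp X Y Z (g : hom Y Z) (f : hom X Y) :
    G1 _ _ (compose g f) = compose (G1 _ _ g) (G1 _ _ f).
  apply: faith; rewrite fmap_comp !preK -!comp_assoc; congr compose; congr compose.
  by rewrite [in RHS]comp_assoc ee' comp_idl.
exists (@Functor D C G0 G1 G1id G1comp); split.
  pose eta X : hom (G0 (F X)) X := pre _ _ (e (F X)).
  exists (eta : forall X, hom (functor_comp (Functor G1 G1id G1comp) F X) (functor_id C X)).
  split=> [X|X Y f] /=.
    by exists (pre _ _ (e' (F X))); split; apply: faith; rewrite fmap_comp !preK fmap_id.
  by apply: faith; rewrite !fmap_comp !preK comp_assoc ee' comp_idl.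
exists (e : forall Z, hom (functor_comp F (Functor G1 G1id G1comp) Z) (functor_id D Z)).
split=> [Z|Y Z f] /=.
  by exists (e' Z).
by rewrite preK comp_assoc ee' comp_idl.
Qed.

(** * Prime filters of a Boolean algebra *)

Section PrimeFilters.
Variables (d : Order.disp_t) (A : ctbDistrLatticeType d).

Lemma spec_ext (F G : Spec A) : (forall x, F x <-> G x) -> F = G.
Proof.
case: F G => [F pF] [G pG] /= h.
have e : F = G by apply/funext => x; apply/propext.
by subst G; congr MkSpec; exact: Prop_irrelevance.
Qed.

Lemma spec_compl (F : Spec A) x : F (~` x) <-> ~ F x.
Proof.
case: F => F [h1 hle hI h0 hU] /=; split.
  by move=> nx fx; apply: h0; rewrite -(meetxC x); exact: hI.
by move=> nx; case: (hU x (~` x)) => //; rewrite joinxC.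
Qed.

Lemma specI (F : Spec A) x y : F (x `&` y) <-> F x /\ F y.
Proof.
case: F => F [h1 hle hI h0 hU] /=; split; last by case; exact: hI.
by move=> h; split; apply: hle h; rewrite ?leIl ?leIr.
Qed.

Lemma specU (F : Spec A) x y : F (x `|` y) <-> F x \/ F y.
Proof.
case: F => F [h1 hle hI h0 hU] /=; split; first exact: hU.
by case; apply: hle; rewrite ?leUl ?leUr.
Qed.

Lemma spec1 (F : Spec A) : F \top. Proof. by case: F => F []. Qed.
Lemma spec0 (F : Spec A) : ~ F \bot. Proof. by case: F => F []. Qed.
Lemma spec_le (F : Spec A) x y : x <= y -> F x -> F y.
Proof. by case: F => F [h1 hle hI h0 hU]; exact: hle. Qed.

Lemma spec_join (F : Spec A) (T : eqType) (s : seq T) (f : T -> A) :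
  F (\join_(x <- s) f x) <-> exists2 x, x \in s & F (f x).
Proof.
elim: s => [|x s IH]; first by rewrite big_nil; split=> [/spec0|[]].
rewrite big_cons specU IH; split.
  case=> [h|[y ys h]]; first by exists x; rewrite ?mem_head.
  by exists y; rewrite // inE ys orbT.
by case=> y; rewrite inE => /orP[/eqP->|ys h]; [left|right; exists y].
Qed.

Definition spec_char (F : Spec A) : boolHom A bool.
Proof.
refine (@BoolHom _ A _ bool (fun x => `[< F x >]) _ _ _ _ _).
- by move=> x y; apply/asboolP/andP => [/specI[? ?]|[/asboolP ? /asboolP ?]];
    [split; apply/asboolP|apply/specI].
- by move=> x y; apply/asboolP/orP => [/specU[?|?]|[/asboolP ?|/asboolP ?]];
    [left; apply/asboolP|right; apply/asboolP|apply/specU; left|apply/specU; right].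
- by apply/asboolP; exact: spec0.
- by apply/asboolP; exact: spec1.
- by move=> x; apply/asboolP/negP => [/spec_compl h /asboolP|h];
    [|apply/spec_compl => ?; apply/h/asboolP].
Defined.

Definition char_spec (g : boolHom A bool) : Spec A.
Proof.
refine (@MkSpec _ A (fun x => g x) _); split.
- by rewrite boolHom1.
- by move=> x y /meet_idPl xy; rewrite -xy boolHomI => /andP[].
- by move=> x y gx gy; rewrite boolHomI; apply/andP.
- by rewrite boolHom0.
- by move=> x y; rewrite boolHomU => /orP.
Defined.

(** The prime filter theorem, in the form used for every compactness argument. Take
    X maximal such that no finite meet of elements of F and X is below an element
    of I. By maximality x is in X unless its meet with some finite meet of elements
    of F and X is below an element of I. So X contains F, and it is prime: two such
    obstructions, for x and for y, combine into one for their join. *)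
Lemma prime_separation (F I : A -> Prop) :
    F \top -> (forall x y, F x -> F y -> F (x `&` y)) ->
    I \bot -> (forall x y, I x -> I y -> I (x `|` y)) ->
    (forall x y, F x -> I y -> ~ x <= y) ->
  exists G : Spec A, (forall x, F x -> G x) /\ (forall x, I x -> ~ G x).
Proof.
move=> F1 FI I0 IU FI0.
pose inn (P : A -> Prop) (s : seq A) := forall x, x \in s -> P x.
pose P (X : A -> Prop) := forall s, inn (fun x => F x \/ X x) s ->
  forall y, I y -> ~ \meet_(x <- s) x <= y.
have [|X [PX Xmax]] := @classical_sets.Zorn_bigcup A P.
  move=> C CP Ctot s.
  (* A finite subset of the union of a chain lies in one of its members; the first
     alternative is needed since the chain may be empty. *)
  have : inn (fun x => F x \/ classical_sets.bigcup C id x) s ->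
     (inn F s \/ exists2 Y, C Y & inn (fun x => F x \/ Y x) s).
    elim: s => [|x s IH] hs; first by left.
    have {}IH := IH (fun y ys => hs y (mem_behead (s := x :: s) ys)).
    have := hs x (mem_head _ _).
    have cons_in (Q : A -> Prop) t : Q x -> inn Q t -> inn Q (x :: t).
      by move=> qx qt y; rewrite inE => /orP[/eqP->|/qt].
    case: IH => [Fs|[Y CY Ys]] [Fx|[Z CZ Zx]].
    - by left; exact: cons_in.
    - by right; exists Z => //; apply: cons_in; [right|move=> y /Fs; left].
    - by right; exists Y => //; apply: cons_in => //; left.
    - case: (Ctot Y Z CY CZ) => YZ; [right; exists Z => //|right; exists Y => //].
        apply: cons_in; [by right|].
        by move=> y /Ys[]; [left|move=> /YZ; right].
      by apply: cons_in => //; right; exact: YZ.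
  move=> h /h {h}[Fs|[Y CY Ys]] y Iy; last exact: (CP Y CY s Ys y Iy).
  apply: FI0 Iy; elim: s Fs => [|x s IH] Fs; first by rewrite big_nil.
  rewrite big_cons; apply: FI; first exact/Fs/mem_head.
  by apply: IH => z zs; apply: Fs; rewrite inE zs orbT.
pose Q x := F x \/ X x.
(* Maximality: X already contains every element that could be added to it. *)
have XP x : (forall s, inn Q s -> forall y, I y -> ~ x `&` \meet_(z <- s) z <= y) -> X x.
  move=> h; apply: contrapT => nXx.
  apply: (Xmax (fun z => X z \/ z = x)).
    by split=> [|/(_ x (or_intror erefl))//]; left.
  move=> s hs y Iy.
  have [t [ht tle]] : exists t, inn Q t /\ x `&` \meet_(z <- t) z <= \meet_(z <- s) z.
    elim: s hs => [|z s IH] hs; first by exists [::]; rewrite !big_nil lex1.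
    have [t [ht tle]] := IH (fun y ys => hs y (mem_behead (s := z :: s) ys)).
    have [Qz|->] : Q z \/ z = x.
      by case: (hs z (mem_head _ _)) => [|[]]; rewrite /Q; auto.
      exists (z :: t); split; first by move=> w; rewrite inE => /orP[/eqP->|/ht].
      by rewrite !big_cons meetCA leI2.
    by exists t; split=> //; rewrite big_cons lexI tle leIl.
  by move=> sy; apply: (h t ht y Iy); exact: le_trans sy.
have inQ (s : seq A) : inn Q s -> forall y, I y -> ~ \meet_(z <- s) z <= y by exact: PX.
have cat_in s t : inn Q s -> inn Q t -> inn Q (s ++ t).
  by move=> hs ht z; rewrite mem_cat => /orP[/hs|/ht].
have cons_in z s : Q z -> inn Q s -> inn Q (z :: s).
  by move=> qz hs w; rewrite inE => /orP[/eqP->|/hs].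
have QX x : Q x -> X x.
  move=> Qx; apply: XP => s hs y Iy.
  by rewrite -(@big_cons _ _ _ _ x s xpredT id); apply: inQ Iy; exact: cons_in.
have nX x : ~ X x -> exists s, inn Q s /\ exists2 y, I y & x `&` \meet_(z <- s) z <= y.
  move=> nXx; apply: contrapT => h; apply/nXx/XP => s hs y Iy le.
  by apply: h; exists s; split=> //; exists y.
have up x s : inn Q s -> \meet_(z <- s) z <= x -> X x.
  move=> hs sx; apply: XP => t ht y Iy xt.
  apply: (inQ (s ++ t)) (Iy) _; first exact: cat_in.
  by rewrite big_cat /=; apply: le_trans xt; exact: leI2.
have hX : is_prime_filter X.
  split.
  - exact/QX/or_introl.
  - move=> x y xy Xx; apply: (up _ [:: x]); last by rewrite big_seq1.
    by move=> z; rewrite inE => /eqP->; right.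
  - move=> x y Xx Xy; apply: (up _ [:: x; y]); last by rewrite big_cons big_seq1.
    by move=> z; rewrite !inE => /orP[]/eqP->; right.
  - move=> X0; apply: (inQ [:: \bot] _ _ I0); last by rewrite big_seq1.
    by move=> z; rewrite inE => /eqP->; right.
  - move=> x y Xxy; apply: contrapT => /not_orP[/nX[s [hs [u Iu su]]] /nX[t [ht [v Iv tv]]]].
    apply: (inQ ((x `|` y) :: s ++ t)) (IU _ _ Iu Iv) _.
      by apply: cons_in; [right|exact: cat_in].
    rewrite big_cons big_cat /= meetUl; apply: leU2.
      by apply: le_trans su; apply: leI2 => //; rewrite leIl.
    by apply: le_trans tv; apply: leI2 => //; rewrite leIr.
exists (MkSpec hX); split=> /= [x Fx|x Ix Xx]; first by apply: QX; left.
apply: (inQ [:: x] _ _ Ix); last by rewrite big_seq1.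
by move=> z; rewrite inE => /eqP->; right.
Qed.

Lemma le_spec x y : (forall G : Spec A, G x -> G y) -> x <= y.
Proof.
move=> h; apply: contrapT => nxy.
have [||||u v xu vy uv|G [Gx Gy]] := @prime_separation (fun u => x <= u) (fun v => v <= y).
- exact: lex1.
- by move=> u v xu xv; rewrite lexI xu.
- exact: le0x.
- by move=> u v uy vy; rewrite leUx uy.
- by apply: nxy; apply: le_trans xu (le_trans uv vy).
by apply: (Gy y) => //; apply/h/Gx.
Qed.

End PrimeFilters.

(** An inequality that fails is witnessed by a prime filter, and the witness lifts
    along h. *)
Lemma boolHom_inj d (A : ctbDistrLatticeType d) d' (A' : ctbDistrLatticeType d')
    (h : boolHom A A') :
  (forall G : Spec A, exists G' : Spec A', spec_map h G' = G) -> injective h.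
Proof.
move=> surj x y hxy.
suff le u v : h u = h v -> u <= v by apply/le_anti; rewrite !le.
by move=> huv; apply: le_spec => G; have [G' <-] := surj G; rewrite /= huv.
Qed.

(** A subalgebra that separates prime filters is everything. For x outside the image
    of h, first separate the part of the image above x from x, by a prime filter G'.
    No element of G' in the image is disjoint from x, because its complement
    would be above x. Hence some prime filter G contains x together with these
    elements. G and G' have the same trace on the image, but only G contains x. *)
Lemma boolHom_surj d (A : ctbDistrLatticeType d) d' (A' : ctbDistrLatticeType d')
    (h : boolHom A A') :
  (forall G G' : Spec A', spec_map h G = spec_map h G' -> G = G') ->
  forall x, exists a, h a = x.
Proof.
move=> inj x; apply: contrapT => nx.
have [||||_ v [a <-] ? vx av|G' [G'F G'x]] :=
    @prime_separation _ A' (fun u => exists2 a, h a = u & x <= u) (fun v => v <= x).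
- by exists \top; rewrite ?boolHom1 ?lex1.
- by move=> _ _ [a <- xa] [b <- xb]; exists (a `&` b); rewrite ?boolHomI ?lexI ?xa.
- exact: le0x.
- by move=> u v uy vy; rewrite leUx uy.
- by apply: nx; exists a; apply/le_anti/andP; split=> //; exact: le_trans vx.
have [||||u v [a Ga <-] vx av|G [GF Gx]] :=
    @prime_separation _ A' (fun u => exists2 a, G' (h a) & h a = u) (fun v => v <= ~` x).
- by exists \top; rewrite boolHom1 //; exact: spec1.
- move=> _ _ [a Ga <-] [b Gb <-]; exists (a `&` b); rewrite boolHomI //; exact/specI.
- exact: le0x.
- by move=> u v uy vy; rewrite leUx uy.
- apply: ((spec_compl G' (h a)).1 _ Ga); rewrite -boolHomC.
  by apply: G'F; exists (~` a); rewrite // boolHomC lexC; exact: le_trans vx.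
have /inj GG' : spec_map h G = spec_map h G'.
  apply: spec_ext => a /=; split=> [Ga|G'a]; last by apply: GF; exists a.
  apply: contrapT => /spec_compl; rewrite -boolHomC => nG'.
  have : G (h (~` a)) by apply: GF; exists (~` a).
  by rewrite boolHomC => /spec_compl.
apply: (G'x x) => //; rewrite -GG'.
by apply: contrapT => /spec_compl; exact: Gx.
Qed.

Lemma boolHom_bij_inverse d (A : ctbDistrLatticeType d) d' (A' : ctbDistrLatticeType d')
    (h : boolHom A A') : injective h -> (forall x, exists a, h a = x) ->
  exists g : boolHom A' A, cancel h g /\ cancel g h.
Proof.
move=> inj surj; pose g x := sval (cid (surj x)).
have gK : cancel g h by move=> x; rewrite /g; case: cid.
have gI : {morph g : x y / x `&` y} by move=> x y; apply: inj; rewrite boolHomI !gK.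
have gU : {morph g : x y / x `|` y} by move=> x y; apply: inj; rewrite boolHomU !gK.
have g0 : g \bot = \bot by apply: inj; rewrite boolHom0 gK.
have g1 : g \top = \top by apply: inj; rewrite boolHom1 gK.
have gC : {morph g : x / ~` x} by move=> x; apply: inj; rewrite boolHomC !gK.
by exists (BoolHom gI gU g0 g1 gC); split=> // a; apply: inj; exact: gK.
Qed.

(** * The free Boolean algebra on a meet-semilattice *)

Section FreeBool.
Variables (d : Order.disp_t) (M : tMeetSemilatticeType d) (B : freeBool M).
Local Notation i := (freeBool_unit B).

Lemma freeBool_liftE d' (A : ctbDistrLatticeType d') (f : mslHom M A) m :
  freeBool_lift B f (i m) = f m.
Proof. by rewrite /freeBool_lift; case: cid => /= g [->]. Qed.

Lemma freeBool_hom_ext d' (A : ctbDistrLatticeType d') (g g' : boolHom B A) :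
  (forall m, g (i m) = g' (i m)) -> g = g'.
Proof.
move=> e; have [h [_ u]] := @freeBoolP _ M B _ A (MslHom (mslHom_fun := fun m => g (i m))
  (fun x y => etrans (congr1 g (mslHomI i x y)) (boolHomI g _ _))
  (etrans (congr1 g (mslHom1 i)) (boolHom1 g))).
by rewrite -(u g) //; apply: u => m; rewrite /= e.
Qed.

Lemma free_le_anti (F G : Spec B) : free_le B F G -> free_le B G F -> F = G.
Proof.
move=> FG GF; have e : spec_char F = spec_char G.
  by apply: freeBool_hom_ext => m; apply: asbool_equiv_eq; split=> [/FG|/GF].
by apply: spec_ext => x; rewrite -(asboolE (F x)) -(asboolE (G x));
   have /= -> := congr1 (fun h : boolHom _ _ => h x) e.
Qed.

Lemma filter_spec (phi : M -> Prop) :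
    phi \top -> (forall x y, phi (x `&` y) <-> phi x /\ phi y) ->
  exists G : Spec B, forall m, G (i m) <-> phi m.
Proof.
move=> phi1 phiI.
have fI : {morph (fun m => `[< phi m >]) : x y / x `&` y}.
  by move=> x y; apply/asboolP/andP => [/phiI[? ?]|[/asboolP ? /asboolP ?]];
    [split; apply/asboolP|apply/phiI].
have f1 : `[< phi \top >] = \top by exact/asboolP.
exists (char_spec (freeBool_lift B (MslHom (N := bool) fI f1))) => m.
by rewrite /= freeBool_liftE /=; split => /asboolP.
Qed.

(** The least prime filter containing the generator m. *)
Lemma principal_spec (m : M) : exists G : Spec B, forall m', G (i m') <-> m <= m'.
Proof.
apply: filter_spec; first exact: lex1.
by move=> x y; rewrite lexI; split => /andP.
Qed.

Lemma unit_le m m' : (i m <= i m') = (m <= m').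
Proof.
apply/idP/idP => [h|/meet_idPl h]; last by apply/meet_idPl; rewrite -mslHomI h.
by have [G Gm] := principal_spec m; apply/Gm/(spec_le h)/Gm.
Qed.

Lemma unit_inj : injective i.
Proof. by move=> m m' e; apply/le_anti; rewrite -!unit_le e lexx. Qed.

Lemma unit_upper m : upper (free_le B) (i m).
Proof. by move=> G G'; exact. Qed.

Lemma free_le_axiom : boolLe_axiom (free_le B).
Proof.
split; first by split=> [F m|F G H FG GH m /FG/GH|F G FG GF] //; exact: free_le_anti.
move=> F F' /existsNP[m /not_implyP[Fm F'm]].
by exists (i m); split=> //; exact: unit_upper.
Qed.

(** If the elements of M in G had no finite meet below b, a prime filter G' would
    contain them all and miss b, against G <= G'. *)
Lemma upper_unit_below (b : B) (G : Spec B) : upper (free_le B) b -> G b ->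
  exists2 m, G (i m) & i m <= b.
Proof.
move=> ub Gb; apply: contrapT => nm.
have [||||_ v [m Gm <-] vb mv|G' [G'F G'b]] := @prime_separation _ B
    (fun u => exists2 m, G (i m) & i m = u) (fun v => v <= b).
- by exists \top; rewrite ?mslHom1 //; exact: spec1.
- by move=> _ _ [m Gm <-] [n Gn <-]; exists (m `&` n); rewrite mslHomI //; apply/specI.
- exact: le0x.
- by move=> u v ub' vb; rewrite leUx ub'.
- by apply: nm; exists m => //; exact: le_trans vb.
apply: (G'b b) => //; apply: ub Gb => m Gm.
by apply: G'F; exists m.
Qed.

(** Compactness: were b not below a finite join of generators below b, some prime
    filter would contain b and miss all these generators, against
    [upper_unit_below]. *)
Lemma upper_join (b : B) : upper (free_le B) b ->
  exists s : seq M, b = \join_(m <- s) i m.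
Proof.
move=> ub.
have sle (s : seq M) : all (fun m => i m <= b) s -> \join_(m <- s) i m <= b.
  by move=> /allP h; apply/joinsP_seq => m ms _; exact: h.
have [h|nh] := pselect
    (exists2 s : seq M, all (fun m => i m <= b) s & b <= \join_(m <- s) i m).
  by case: h => s /sle h1 h2; exists s; apply/le_anti; rewrite h1 h2.
have [||||u _ bu [s hs <-] us|G [Gb Gs]] := @prime_separation _ B
    (fun u => b <= u) (fun v => exists2 s : seq M, all (fun m => i m <= b) s &
       \join_(m <- s) i m = v).
- exact: lex1.
- by move=> u v bu bv; rewrite lexI bu.
- by exists [::]; rewrite ?big_nil.
- by move=> _ _ [s hs <-] [t ht <-]; exists (s ++ t); rewrite ?all_cat ?hs // big_cat.
- by case: nh; exists s => //; exact: le_trans us.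
have [m Gm mb] := upper_unit_below ub (Gb b (lexx b)).
by case: (Gs (i m)) => //; exists [:: m]; rewrite ?big_seq1 //= mb.
Qed.

(** Every prime filter containing the generator m is above the principal one, so an
    upper element in the principal one is above m. *)
Lemma unit_indecomposable m : indecomposable (free_le B) (i m).
Proof.
split=> [|s us e]; first exact: unit_upper.
have [G Gm] := principal_spec m.
have : G (i m) by exact/Gm.
rewrite {1}e => /spec_join[x xs Gx].
suff -> : i m = x by [].
apply/le_anti; rewrite {2}e joins_sup_seq // andbT.
apply: le_spec => G' G'm; apply: us Gx => // n /Gm.
by rewrite -unit_le => /spec_le; exact.
Qed.

Lemma indecomposable_unit b :
  indecomposable (free_le B) b <-> exists m, i m = b.
Proof.
split=> [[/upper_join[s e] h]|[m <-]]; last exact: unit_indecomposable.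
have /mapP[m _ ->] : b \in map i s; last by exists m.
apply: h; last by rewrite big_map.
by move=> _ /mapP[m _ ->]; exact: unit_upper.
Qed.

End FreeBool.

(** * Indecomposable elements and morphisms *)

Section Induced.
Variables (d : Order.disp_t) (B : tMeetSemilatticeType d) (P : B -> Prop) (h : is_msl P).

Definition in_induced (x : B) (px : P x) : induced h :=
  exist (fun x => is_true `[< P x >]) x (asboolT px).

Lemma induced_valP (x : induced h) : P (val x). Proof. exact: asboolW (valP x). Qed.

Lemma induced_valI (x y : induced h) : P (val x `&` val y) ->
  val (x `&` y) = val x `&` val y.
Proof.
move=> Pxy; pose z := in_induced Pxy.
apply/le_anti; rewrite lexI !Order.le_val leIl leIr /=.
have : z <= x `&` y by rewrite lexI -!Order.le_val /= leIl leIr.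
by rewrite -Order.le_val.
Qed.

Lemma induced_val1 : P \top -> val (\top : induced h) = \top.
Proof.
move=> P1; pose z := in_induced P1.
apply/le_anti; rewrite lex1 /=.
have : z <= \top by exact: lex1.
by rewrite -Order.le_val.
Qed.

End Induced.

Local Notation indec X := (indecomposable (boolLe_le X)).

Lemma arrow_upper (X Y : boolLe) (f : boolLeHom X Y) (b : X) :
  upper (boolLe_le X) b -> upper (boolLe_le Y) (f b).
Proof. by move=> ub G G' GG'; exact: (ub _ _ (boolLeHomP f GG')). Qed.

(** Morphisms preserve upper elements, so a decomposition of f b is carried by the
    inverse g to a decomposition of b. *)
Lemma inverse_indecomposable (X Y : boolLe) (f : boolLeHom X Y) (g : boolLeHom Y X) :
  cancel f g -> cancel g f -> forall b : X, indec X b -> indec Y (f b).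
Proof.
move=> fK gK b [ub hb]; split=> [|s us e]; first exact: arrow_upper.
have : b \in map g s.
  apply: hb; first by move=> _ /mapP[x xs ->]; apply: arrow_upper; exact: us.
  rewrite -[b]fK e big_map; apply: (big_morph g); [exact: boolHomU|exact: boolHom0].
by move=> /mapP[x xs ->]; rewrite gK.
Qed.

Lemma is_iso_cancel (X Y : BoolLe) (f : @hom BoolLe X Y) : is_iso f ->
  exists g : boolLeHom Y X, cancel (f : boolLeHom X Y) g /\ cancel g (f : boolLeHom X Y).
Proof.
move=> [g [gf fg]]; exists g; split=> x.
  by have /= := congr1 (fun k : boolLeHom X X => k x) gf.
by have /= := congr1 (fun k : boolLeHom Y Y => k x) fg.
Qed.

Lemma cancel_is_iso (X Y : boolLe) (f : boolLeHom X Y) (g : boolLeHom Y X) :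
  cancel f g -> cancel g f -> is_iso (f : @hom BoolLe X Y).
Proof. by move=> fK gK; exists (g : @hom BoolLe Y X); split; apply: boolLeHom_ext. Qed.

(** The condition on the top element is closure under the empty meet; it makes the
    inclusion of the indecomposables a homomorphism of meet-semilattices. *)
Definition semilattice_like (X : boolLe) : Prop :=
  [/\ separated_by (boolLe_le X) (indec X), indec X \top &
      forall a b : X, indec X a -> indec X b -> indec X (a `&` b)].

Definition semilattice_like_sub : subcategory BoolLe.
Proof.
refine (@Subcategory BoolLe semilattice_like
  (fun X Y f => [/\ semilattice_like X, semilattice_like Y &
     forall b, indec X b -> indec Y ((f : boolLeHom X Y) b)]) _ _ _ _).
- by move=> X Y f [].
- by move=> X Y f [].
- by move=> X hX; split.
- by move=> X Y Z g f [hY hZ hg] [hX _ hf]; split=> // b /hf/hg.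
Defined.

Lemma semilattice_like_closed : closed_under_isos semilattice_like_sub.
Proof.
move=> X Y f /is_iso_cancel[g [fK gK]] [sep i1 iI].
have hf := inverse_indecomposable fK gK; have hg := inverse_indecomposable gK fK.
suff hY : semilattice_like Y by split.
split.
- move=> F F' nFF'.
  have /sep[b [ib Fb F'b]] : ~ boolLe_le X (spec_map f F) (spec_map f F').
    move=> /(boolLeHomP g) h; apply: nFF'.
    have e G : spec_map g (spec_map f G) = G by apply: spec_ext => y /=; rewrite gK.
    by rewrite !e in h.
  by exists ((f : boolLeHom X Y) b); split=> //; exact: hf.
- by rewrite -(boolHom1 (f : boolLeHom X Y)); exact: hf.
- move=> a b ia ib; rewrite -[a]gK -[b]gK -boolHomI.
  by apply/hf/iI; exact: hg.
Qed.

Lemma semilattice_like_msl (X : boolLe) : semilattice_like X -> is_msl (indec X).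
Proof.
move=> [_ i1 iI]; split; first by exists \top; split=> // x _; exact: lex1.
by move=> x y ix iy; exists (x `&` y); split=> [|w _]; [exact: iI|exact: lexI].
Qed.

(** Indecomposables are join-prime among themselves: if a is below the join of s,
    then a is the join of its meets with the elements of s, which are again
    indecomposable, so a is one of these meets. *)
Lemma indecomposable_le_join (X : boolLe) (a : X) (s : seq X) : semilattice_like X ->
  indec X a -> (forall x, x \in s -> indec X x) -> a <= \join_(x <- s) x ->
  exists2 x, x \in s & a <= x.
Proof.
move=> [_ _ iI] ia is_ /meet_idPl e.
have /mapP[x xs ax] : a \in map (fun x => a `&` x) s.
  apply: ia.2.
    by move=> _ /mapP[x xs ->]; apply: (iI _ _ ia (is_ x xs)).1.
  rewrite big_map -{1}e; apply: (big_morph (fun x => a `&` x)).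
  by move=> x y; rewrite meetUr.
  by rewrite meetx0.
by exists x => //; rewrite ax leIr.
Qed.

Definition msl_incl (X : boolLe) (hX : semilattice_like X)
  (h : is_msl (indec X)) : mslHom (induced h) X :=
  MslHom (mslHom_fun := fun x : induced h => val x : X)
    (fun x y => induced_valI
       (let: And3 _ _ iI := hX in iI _ _ (induced_valP x) (induced_valP y)))
    (induced_val1 h (let: And3 _ i1 _ := hX in i1)).

(** * The functor *)

Section Btilde.
Variable B : forall M : mslat, freeBool M.

Lemma Bmap_unit (M N : mslat) (f : mslHom M N) m :
  Bmap B f (freeBool_unit (B M) m) = freeBool_unit (B N) (f m).
Proof. exact: freeBool_liftE. Qed.

Lemma Bmap_monotone (M N : mslat) (f : mslHom M N) :
  spec_monotone (free_le (B M)) (free_le (B N)) (Bmap B f).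
Proof. by move=> F F' FF' m; rewrite /= Bmap_unit; exact: FF'. Qed.

Definition Btilde_ob (M : MsLat) : BoolLe := MkBoolLe (free_le_axiom (B M)).
Definition Btilde_hom (M N : MsLat) (f : hom M N) : hom (Btilde_ob M) (Btilde_ob N) :=
  @MkBoolLeHom (Btilde_ob M) (Btilde_ob N) (Bmap B f) (@Bmap_monotone M N f).

Lemma Btilde_id (M : MsLat) : Btilde_hom (idm M) = idm (Btilde_ob M).
Proof.
apply: boolLeHom_ext => x; congr (boolHom_fun _ x).
by apply: freeBool_hom_ext => m; rewrite Bmap_unit.
Qed.

Lemma Btilde_comp (L M N : MsLat) (g : hom M N) (f : hom L M) :
  Btilde_hom (compose g f) = compose (Btilde_hom g) (Btilde_hom f).
Proof.
apply: boolLeHom_ext => x.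
have e : Bmap B (compose g f) = boolHom_comp (Bmap B g) (Bmap B f).
  by apply: freeBool_hom_ext => m; rewrite /= !Bmap_unit.
exact: (congr1 (fun u : boolHom (B L) (B N) => u x) e).
Qed.

Definition Btilde : functor MsLat BoolLe := Functor Btilde_hom Btilde_id Btilde_comp.

Lemma Btilde_factors : factors_through Btilde semilattice_like_sub.
Proof.
have hM (M : MsLat) : semilattice_like (Btilde M).
  split.
  - move=> F F' /existsNP[m /not_implyP[Fm F'm]].
    by exists (freeBool_unit (B M) m); split=> //; exact: unit_indecomposable.
  - by rewrite -(mslHom1 (freeBool_unit (B M))); exact: unit_indecomposable.
  - move=> _ _ /indecomposable_unit[a <-] /indecomposable_unit[b <-].
    by rewrite -mslHomI; exact: unit_indecomposable.
split=> [M|M N f]; first exact: hM.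
split=> // _ /indecomposable_unit[m <-]; rewrite /= Bmap_unit.
exact: unit_indecomposable.
Qed.

(** * Recovering an ordered Boolean algebra from its indecomposables *)

Section Recover.
Variables (X : boolLe) (hX : semilattice_like X) (h : is_msl (indec X)).
Let M : mslat := Mslat (induced h).
Let e : boolHom (B M) X := freeBool_lift (B M) (msl_incl hX h).

Let eE (x : induced h) : e (freeBool_unit (B M) x) = val x.
Proof. exact: (freeBool_liftE _ (msl_incl hX h)). Qed.

(** A prime filter G of the free algebra is pulled back from X: the indecomposables
    in G, closed under meets, can be separated from the finite joins of those
    outside G by [indecomposable_le_join]. *)
Lemma recover_inj : injective e.
Proof.
apply: boolHom_inj => G; have [sep i1 iI] := hX.
have [||||u _ [m Gm <-] [s hs <-] le|G' [G'F G'I]] := @prime_separation _ X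
    (fun u => exists2 m : induced h, G (freeBool_unit (B M) m) & val m = u)
    (fun v => exists2 s : seq (induced h),
       (forall m, m \in s -> ~ G (freeBool_unit (B M) m)) & \join_(m <- s) (val m : X) = v).
- exists \top; last exact: (mslHom1 (msl_incl hX h)).
  by rewrite (mslHom1 (freeBool_unit (B M))); exact: spec1.
- move=> _ _ [m Gm <-] [n Gn <-]; exists (m `&` n); last exact: (mslHomI (msl_incl hX h)).
  by rewrite (mslHomI (freeBool_unit (B M))); exact/specI.
- by exists [::]; rewrite ?big_nil.
- move=> _ _ [s hs <-] [t ht <-]; exists (s ++ t); last by rewrite big_cat.
  by move=> m; rewrite mem_cat => /orP[/hs|/ht].
- have [||x] := @indecomposable_le_join X (val m) (map val s) hX (induced_valP m).
  + by move=> _ /mapP[n _ ->]; exact: induced_valP.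
  + by rewrite big_map.
  move=> /mapP[n ns ->]; rewrite Order.le_val -(unit_le (B M)) => mn.
  by apply: (hs n ns); exact: spec_le mn Gm.
exists G'; apply: (@free_le_anti _ _ (B M)) => m; rewrite /= eE.
  move=> G'm; apply: contrapT => nGm; apply: (G'I (val m)) => //.
  by exists [:: m]; rewrite ?big_seq1 // => n; rewrite inE => /eqP->.
by move=> Gm; apply: G'F; exists m.
Qed.

(** One direction holds because indecomposables are upper, the other because they
    separate the order. *)
Lemma recover_le (F F' : Spec X) :
  boolLe_le X F F' <-> free_le (B M) (spec_map e F) (spec_map e F').
Proof.
split=> [FF' m|le]; first by rewrite /= eE; exact: (induced_valP m).1 _ _ FF'.
have [sep _ _] := hX; apply: contrapT => /sep[b [ib Fb]]; apply.
by have := le (in_induced h ib); rewrite /= eE; exact.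
Qed.

(** By [recover_le] and antisymmetry, the pullback of prime filters along e is
    injective. *)
Lemma recover_surj x : exists a, e a = x.
Proof.
apply: boolHom_surj => F G FG; have [[_ _ anti] _] := boolLeP X.
by apply: anti; apply/recover_le; rewrite FG.
Qed.

Lemma recover_arrows : exists (f : boolLeHom (Btilde M) X) (g : boolLeHom X (Btilde M)),
  cancel f g /\ cancel g f.
Proof.
have [g [eK gK]] := boolHom_bij_inverse recover_inj recover_surj.
have em : spec_monotone (boolLe_le (Btilde M)) (boolLe_le X) e.
  by move=> F F' /recover_le.
have gm : spec_monotone (boolLe_le X) (boolLe_le (Btilde M)) g.
  move=> F F' FF'; apply/recover_le.
  have E G : spec_map e (spec_map g G) = G by apply: spec_ext => x /=; rewrite eK.
  by rewrite !E.
by exists (@MkBoolLeHom (Btilde M) X e em), (@MkBoolLeHom X (Btilde M) g gm); split.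
Qed.

(** Freeness is transported along the isomorphism e. *)
Lemma recover_free : is_free (msl_incl hX h).
Proof.
have [g [eK gK]] := boolHom_bij_inverse recover_inj recover_surj.
move=> d A f; exists (boolHom_comp (freeBool_lift (B M) f) g); split.
  by move=> x; rewrite /= -eE eK freeBool_liftE.
move=> k hk; apply: boolHom_ext => x /=; rewrite -[in RHS](gK x).
have -> // : freeBool_lift (B M) f = boolHom_comp k e.
by apply: freeBool_hom_ext => m; rewrite freeBool_liftE /= eE -hk.
Qed.

End Recover.

(** * The extended image *)

(** The objects on the right form a competitor in the intersection defining the
    extended image; conversely each is isomorphic, by [recover_arrows], to an object
    in the image of the functor, hence lies in every competitor. *)
Lemma extIm_ob (X : boolLe) : sub_ob (ExtIm Btilde) X <-> semilattice_like X.
Proof.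
split=> [h|hX S]; first exact: (h _ semilattice_like_closed Btilde_factors).
move=> Scl [Sob _].
have [f [g [fK gK]]] := recover_arrows hX (semilattice_like_msl hX).
exact: (Scl _ _ _ (cancel_is_iso fK gK) (Sob _)).1.
Qed.

Lemma Btilde_full (M N : mslat) (f : boolLeHom (Btilde M) (Btilde N)) :
    (forall b, indec (Btilde M) b -> indec (Btilde N) (f b)) ->
  exists k : mslHom M N, Btilde_hom (k : @hom MsLat M N) = f.
Proof.
move=> hf.
have ex m : exists n, freeBool_unit (B N) n = f (freeBool_unit (B M) m).
  exact/indecomposable_unit/hf/indecomposable_unit/ex_intro.
pose k m := sval (cid (ex m)).
have kE m : freeBool_unit (B N) (k m) = f (freeBool_unit (B M) m) by rewrite /k; case: cid.
have kI : {morph k : x y / x `&` y}.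
  by move=> x y; apply: (@unit_inj _ _ (B N)); rewrite mslHomI !kE mslHomI boolHomI.
have k1 : k \top = \top.
  by apply: (@unit_inj _ _ (B N)); rewrite kE !mslHom1 boolHom1.
exists (MslHom kI k1); apply: boolLeHom_ext => x; congr (boolHom_fun _ x).
by apply: freeBool_hom_ext => m; rewrite Bmap_unit -kE.
Qed.

(** Conjugating f by the isomorphisms of [recover_arrows] gives a morphism between
    free algebras that preserves indecomposables, hence an arrow in the image of the
    functor; f is its composite with isomorphisms. *)
Lemma extIm_hom (X Y : boolLe) (f : boolLeHom X Y) :
    sub_ob (ExtIm Btilde) X -> sub_ob (ExtIm Btilde) Y ->
  sub_hom (ExtIm Btilde) (f : @hom BoolLe X Y) <-> forall b, indec X b -> indec Y (f b).
Proof.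
move=> /extIm_ob hX /extIm_ob hY; split.
  by move/(_ _ semilattice_like_closed Btilde_factors) => [].
move=> hf S Scl [Sob Shom].
have [eX [gX [eXK gXK]]] := recover_arrows hX (semilattice_like_msl hX).
have [eY [gY [eYK gYK]]] := recover_arrows hY (semilattice_like_msl hY).
set M := Mslat _ in eX gX eXK gXK; set N := Mslat _ in eY gY eYK gYK.
have [|k kE] := @Btilde_full M N (boolLeHom_comp gY (boolLeHom_comp f eX)).
  move=> b ib; apply: (inverse_indecomposable gYK eYK); apply: hf.
  exact: (inverse_indecomposable eXK gXK).
have -> : f = boolLeHom_comp eY (boolLeHom_comp (Btilde_hom (k : @hom MsLat M N)) gX).
  by apply: boolLeHom_ext => x; rewrite kE /= gXK gYK.
have SX := (Scl _ _ _ (cancel_is_iso eXK gXK) (Sob _)).1.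
apply: (sub_comp (s := S)); first exact: (Scl _ _ _ (cancel_is_iso eYK gYK) (Sob _)).2.
apply: (sub_comp (s := S)); first exact: Shom.
exact: (Scl _ _ _ (cancel_is_iso gXK eXK) SX).2.
Qed.

Lemma extIm_equivalence : is_equivalence (to_ExtIm Btilde).
Proof.
apply: ff_eso_equivalence => [M N [f hf]|[X eX]].
  have [|k kE] := @Btilde_full M N f.
    by have [] := hf _ semilattice_like_closed Btilde_factors.
  exists k; split; first exact: sig_ext.
  move=> k' /(congr1 sval) /= k'E; apply: mslHom_ext => m.
  apply: (@unit_inj _ _ (B N)); rewrite -!Bmap_unit.
  exact: (congr1 (fun u : boolLeHom (Btilde M) (Btilde N) => u (freeBool_unit (B M) m))
    (etrans kE (esym k'E))).
have /extIm_ob hX := eX.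
have [f [g [fK gK]]] := recover_arrows hX (semilattice_like_msl hX).
set M := Mslat _ in f g fK gK.
have SM : sub_ob (ExtIm Btilde) (Btilde M) by exact/extIm_ob/(Btilde_factors.1 M).
exists (M : MsLat).
have Sf := (extIm_hom f SM eX).2 (inverse_indecomposable fK gK).
have Sg := (extIm_hom g eX SM).2 (inverse_indecomposable gK fK).
exists (exist _ (f : @hom BoolLe (Btilde M) X) Sf).
exists (exist _ (g : @hom BoolLe X (Btilde M)) Sg).
by split; apply: sig_ext; apply: boolLeHom_ext.
Qed.

(** If the inclusion of the indecomposables is a homomorphism, their induced meets and
    top are those of X, so they are closed under finite meets in X. *)
Lemma extIm_ob_free (X : boolLe) : sub_ob (ExtIm Btilde) X <->
  (exists h : is_msl (indec X), free_on_subset h) /\ separated_by (boolLe_le X) (indec X).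
Proof.
rewrite extIm_ob; split=> [hX|[[h [i iE _]] sep]].
  split; last by case: hX.
  exists (semilattice_like_msl hX); exists (msl_incl hX (semilattice_like_msl hX)) => //.
  exact: recover_free.
split=> // [|a b ia ib]; first by rewrite -(mslHom1 i) iE; exact: induced_valP.
have := induced_valP (in_induced h ia `&` in_induced h ib).
by rewrite -iE mslHomI !iE.
Qed.

End Btilde.

Theorem mainTheorem4 (B : forall M : mslat, freeBool M) :
  exists (B_ob : forall M : mslat, boolLe_axiom (free_le (B M)))
         (B_hom : forall (M N : mslat) (f : mslHom M N),
            spec_monotone (free_le (B M)) (free_le (B N)) (Bmap B f)),
  let Bt_ob (M : MsLat) : BoolLe := MkBoolLe (B_ob M) in
  let Bt_hom (M N : MsLat) (f : hom M N) : hom (Bt_ob M) (Bt_ob N) :=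
    @MkBoolLeHom (Bt_ob M) (Bt_ob N) (Bmap B f) (B_hom M N f) in
  exists (B_id : forall M : MsLat, Bt_hom M M (idm M) = idm (Bt_ob M))
         (B_comp : forall (L M N : MsLat) (g : hom M N) (f : hom L M),
            Bt_hom L N (compose g f) = compose (Bt_hom M N g) (Bt_hom L M f)),
  let Bt : functor MsLat BoolLe := Functor Bt_hom B_id B_comp in
  let indec (X : boolLe) : X -> Prop := indecomposable (boolLe_le X) in
  let i (M : mslat) : mslHom M (B M) := freeBool_unit (B M) in
  [/\ is_equivalence (to_ExtIm Bt),

      (forall M : mslat,
         (forall m m' : M, (i M m <= i M m') = (m <= m')) /\
         (forall b : B M, indec (Bt M) b <-> exists m : M, i M m = b)),
      (forall (M N : mslat) (f : mslHom M N),
         (forall b : B M, indec (Bt M) b -> indec (Bt N) (fmap Bt f b)) /\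
         (forall m : M, fmap Bt f (i M m) = i N (f m))),

      (forall X : boolLe,
         (sub_ob (ExtIm Bt) X <->
            [/\ separated_by (boolLe_le X) (indec X),
                (* the empty meet; binary meets alone do not suffice *)
                indec X \top &
                forall a b : X, indec X a -> indec X b -> indec X (a `&` b)]) /\
         (sub_ob (ExtIm Bt) X <->
            (exists h : is_msl (indec X), free_on_subset h) /\
            separated_by (boolLe_le X) (indec X))) &

      (forall X Y : boolLe, sub_ob (ExtIm Bt) X -> sub_ob (ExtIm Bt) Y ->
         forall f : boolHom X Y,
           (exists hf : spec_monotone (boolLe_le X) (boolLe_le Y) f,
              sub_hom (ExtIm Bt) (MkBoolLeHom hf : @hom BoolLe X Y)) <->
           spec_monotone (boolLe_le X) (boolLe_le Y) f /\
           (forall b : X, indec X b -> indec Y (f b)))].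
Proof.
exists (fun M => free_le_axiom (B M)), (@Bmap_monotone B) => Bt_ob Bt_hom.
exists (Btilde_id B), (Btilde_comp B) => Bt indec i; split.
- exact: extIm_equivalence.
- by move=> M; split=> [m m'|b]; [exact: unit_le|exact: indecomposable_unit].
- move=> M N f; split; last exact: Bmap_unit.
  by case: ((Btilde_factors B).2 M N f).
- by move=> X; split; [exact: extIm_ob|exact: extIm_ob_free].
- move=> X Y hX hY f; split=> [[hf /(extIm_hom _ hX hY) h]|[hf h]].
    by split.
  by exists hf; apply/(extIm_hom _ hX hY).
Qed.
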